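(* Let $(X,+)$ and $(Y,+)$ be abelian Polish groups, and let $\mathcal{I}$ be a $\sigma$-ideal on $X$ and $\mathcal{J}$ a $\sigma$-ideal on $Y$, each containing all singletons and having a Borel base. Suppose that $\mathcal{I}$ and $\mathcal{J}$ have the Weaker Smital Property (WSP) and assume one of the following: (i) $\mathcal{J}$ is Borel-on-Borel; (ii) $\mathcal{J}$ is measurable-on-measurable; (iii) $(\mathrm{Bor}(X\times Y),\mathcal{I}\otimes\mathcal{J})$ has the positive rectangle property (PRP). Then $\mathcal{I}\otimes\mathcal{J}$ also has WSP.
   Context: $\mathrm{Bor}(Z)$ denotes the Borel subsets of $Z$. A $\sigma$-ideal $\mathcal{K}$ on $Z$ has a Borel base if every member of $\mathcal{K}$ is contained in a Borel member of $\mathcal{K}$. A set is $\mathcal{K}$-positive if it is not in $\mathcal{K}$, and $\mathcal{K}$-residual if its complement is in $\mathcal{K}$. $A+B=\{a+b:a\in A,b\in B\}$. For $H\subseteq X\times Y$ and $x\in X$, $H_x=\{y\in Y:(x,y)\in H\}$. WSP for a $\sigma$-ideal $\mathcal{K}$ on an abelian Polish group $Z$: there exists a countable dense set $D\subseteq Z$ such that for every $A\in\mathrm{Bor}(Z)\setminus\mathcal{K}$ the set $A+D$ is $\mathcal{K}$-residual. Fubini product: $K\in\mathcal{I}\otimes\mathcal{J}$ iff there is a Borel set $C\subseteq X\times Y$ with $K\subseteq C$ and $\{x\in X: C_x\notin\mathcal{J}\}\in\mathcal{I}$. For a family $\mathcal{D}$, $\sigma(\mathcal{D})$ is the $\sigma$-algebra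 generated by $\mathcal{D}$. $\mathcal{J}$ is Borel-on-Borel if for every $H\in\mathrm{Bor}(X\times Y)$ we have $\{x\in X: H_x\in\mathcal{J}\}\in\mathrm{Bor}(X)$. $\mathcal{J}$ is measurable-on-measurable if for every $H\in\sigma(\mathrm{Bor}(X\times Y)\cup\mathcal{I}\otimes\mathcal{J})$ we have $\{x\in X:H_x\in\mathcal{J}\}\in\sigma(\mathrm{Bor}(X)\cup\mathcal{I})$. PRP for $(\mathrm{Bor}(X\times Y),\mathcal{I}\otimes\mathcal{J})$: for every $\mathcal{I}\otimes\mathcal{J}$-positive Borel set $A\subseteq X\times Y$ there is an $\mathcal{I}\otimes\mathcal{J}$-positive rectangle $R=P\times Q$ with $P\in\mathrm{Bor}(X)$, $Q\in\mathrm{Bor}(Y)$ such that $R\subseteq A\cup K$ for some $K\in\mathcal{I}\otimes\mathcal{J}$. *)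

(* Defs.v *)
From HB Require Import structures.
From mathcomp Require Import all_boot all_order all_algebra.
From mathcomp Require Import all_classical all_reals all_analysis.

Set Implicit Arguments.
Unset Strict Implicit.
Unset Printing Implicit Defensive.

Import GRing.Theory.

Local Open Scope classical_set_scope.
Local Open Scope ring_scope.

(* Separable and completely metrizable.  The complete metric lives on a
   homeomorphic copy M of T, so T itself carries only its topology; in
   particular, on a topological group the metric need not be invariant. *)
Definition polish (R : realType) (T : topologicalType) : Prop :=
  (exists2 D : set T, countable D & dense D) /\
  exists (M : metricType R) (f : T -> M) (g : M -> T),
    [/\ cancel f g, cancel g f, continuous f, continuous g &
        forall F : set_system M, ProperFilter F -> cauchy F ->
          exists x : M, F --> x].

Definition Bor (T : topologicalType) : set (set T) := <<s @open T >>.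

(* Properness (setT not in K) is not required. *)
Definition sigma_ideal (T : Type) (K : set (set T)) : Prop :=
  [/\ K set0,
      forall A B : set T, A `<=` B -> K B -> K A &
      forall F : (set T)^nat, (forall n, K (F n)) -> K (\bigcup_n F n)].

Definition contains_singletons (T : Type) (K : set (set T)) : Prop :=
  forall x : T, K [set x].

Definition has_borel_base (T : topologicalType) (K : set (set T)) : Prop :=
  forall A : set T, K A -> exists B : set T, [/\ Bor B, K B & A `<=` B].

Definition positive (T : Type) (K : set (set T)) (A : set T) : Prop := ~ K A.

Definition residual (T : Type) (K : set (set T)) (A : set T) : Prop :=
  K (~` A).

Definition sumset (Z : zmodType) (A B : set Z) : set Z :=
  [set a + b | a in A & b in B].

(* Makes Rocq infer the PreTopologicalZmodule structure (product topology,
   componentwise addition) on X * Y from the instances already declared. *)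
HB.saturate prod.

(* PreTopologicalZmodule (an abelian group with a topology) rather than
   topologicalZmodType, because the library infers topologicalZmodType on a
   product only for topological vector spaces. *)
Definition WSP (Z : PreTopologicalZmodule.type) (K : set (set Z)) : Prop :=
  exists D : set Z, [/\ countable D, dense D &
    forall A : set Z, Bor A -> positive K A -> residual K (sumset A D)].

Section product.
Variables X Y : topologicalType.

Definition fubini_product (I : set (set X)) (J : set (set Y)) :
    set (set (X * Y)) :=
  [set K | exists C : set (X * Y),
    [/\ Bor C, K `<=` C & I [set x | ~ J (xsection C x)]]].

Definition borel_on_borel (J : set (set Y)) : Prop :=
  forall H : set (X * Y), Bor H -> Bor [set x | J (xsection H x)].

Definition measurable_on_measurable (I : set (set X)) (J : set (set Y)) :
    Prop :=
  forall H : set (X * Y),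
    <<s @Bor (X * Y)%type `|` fubini_product I J >> H ->
    <<s @Bor X `|` I >> [set x | J (xsection H x)].

Definition PRP (I : set (set X)) (J : set (set Y)) : Prop :=
  forall A : set (X * Y), Bor A -> positive (fubini_product I J) A ->
    exists (P : set X) (Q : set Y),
      [/\ Bor P, Bor Q, positive (fubini_product I J) (P `*` Q) &
          exists2 K : set (X * Y), fubini_product I J K &
            P `*` Q `<=` A `|` K].

End product.

Arguments borel_on_borel X {Y} J.

(* Main.v *)
Require Import Defs.
From HB Require Import structures.
From mathcomp Require Import all_boot all_order all_algebra.
From mathcomp Require Import all_classical all_reals all_analysis.

(** Let [D1] and [D2] witness the property for [I] and [J]; then [D1 `*` D2]
    witnesses it for the product. Take a positive Borel set [A]; then the set
    [E] of those [x] whose section [A_x] is not in [J] is not in [I]. If [E]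
    contains a Borel set [B] outside [I], then for [x] in [B] and [d] in [D1]
    the section of [A + D1 `*` D2] at [x + d] contains [A_x + D2], hence is
    [J]-residual; so all sections over [B + D1], an [I]-residual set, are
    [J]-residual ([residual_sumset_of_positive_fibres]). This argument works
    section by section and so does not translate members of the ideals, which
    need not be translation invariant.

    It remains to find [B]. If [J] is Borel-on-Borel, [E] itself is Borel. If
    [J] is measurable-on-measurable, [E] is a Borel set up to a member of [I]
    ([borel_core_of_measurable]). If the positive rectangle property holds,
    pick a rectangle [P `*` Q] inside [A] up to a set [K] of the product
    ideal, and remove from [P] a Borel member of [I] that contains all [x]
    with [K_x] outside [J] ([borel_core_of_rectangle]). *)

Set Implicit Arguments.
Unset Strict Implicit.
Unset Printing Implicit Defensive.

Import GRing.Theory.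

Local Open Scope classical_set_scope.
Local Open Scope ring_scope.

Section sigma_ideals.
Variables (T : Type) (K : set (set T)).
Hypothesis hK : sigma_ideal K.

Lemma sigma_ideal_sub A B : A `<=` B -> K B -> K A.
Proof. by case: hK => _ + _; apply. Qed.

Lemma sigma_idealU A B : K A -> K B -> K (A `|` B).
Proof.
case: hK => K0 _ Kbig KA KB; rewrite -bigcup2E; apply: Kbig => -[|[|n]] //.
Qed.

End sigma_ideals.

Section borel.
Variable T : topologicalType.
Implicit Types A B : set T.

Lemma Bor_open A : open A -> Bor A.
Proof. exact: sub_sigma_algebra. Qed.

Lemma Bor_set0 : Bor (set0 : set T).
Proof. by case: (smallest_sigma_algebra setT (@open T)). Qed.

Lemma BorC A : Bor A -> Bor (~` A).
Proof.
have [_ compl _] := smallest_sigma_algebra setT (@open T).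
by rewrite -setTD; exact: compl.
Qed.

Lemma Bor_bigcup (F : (set T)^nat) :
  (forall n, Bor (F n)) -> Bor (\bigcup_n F n).
Proof.
by move=> bF; have [_ _ cup] := smallest_sigma_algebra setT (@open T); exact: cup.
Qed.

Lemma BorU A B : Bor A -> Bor B -> Bor (A `|` B).
Proof.
move=> bA bB; rewrite -bigcup2E; apply: Bor_bigcup => -[|[|n]] //=.
exact: Bor_set0.
Qed.

Lemma BorD A B : Bor A -> Bor B -> Bor (A `\` B).
Proof.
move=> bA bB; rewrite -[A `\` B]setCK setCD.
by apply: BorC; apply: BorU => //; exact: BorC.
Qed.

End borel.

Lemma Bor_preimage (S T : topologicalType) (f : S -> T) (B : set T) :
  continuous f -> Bor B -> Bor (f @^-1` B).
Proof.
move=> /continuousP fcont; move: B.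
apply: smallest_sub => [|B oB]; last by apply: Bor_open; exact: fcont.
split=> [|B bB|F bF] /=.
- by rewrite preimage_set0; exact: Bor_set0.
- by rewrite setTD preimage_setC; exact: BorC.
- by rewrite preimage_bigcup; exact: Bor_bigcup.
Qed.

Lemma Bor_xsection (X Y : topologicalType) (A : set (X * Y)) (x : X) :
  Bor A -> Bor (xsection A x).
Proof.
move=> bA; rewrite (_ : xsection A x = (fun y => (x, y)) @^-1` A).
  by apply: Bor_preimage => // y; apply: cvg_pair; [exact: cvg_cst|exact: cvg_id].
by apply/seteqP; split=> y /=; rewrite /xsection /= inE.
Qed.

Lemma dense_setX (X Y : topologicalType) (D1 : set X) (D2 : set Y) :
  dense D1 -> dense D2 -> dense (D1 `*` D2).
Proof.
move=> d1 d2 O [[a b] Oab] oO.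
have : nbhs (a, b) O by exact: open_nbhs_nbhs.
move=> [[U V] /= [Ua Vb] UVO].
have [x [Ux D1x]] : (U° `&` D1) !=set0.
  by apply: d1; [exists a|exact: open_interior].
have [y [Vy D2y]] : (V° `&` D2) !=set0.
  by apply: d2; [exists b|exact: open_interior].
by exists (x, y); split=> //; apply: UVO; split; exact: interior_subset.
Qed.

(** For countable [D] the sumset is a countable union of translates, so only
    continuity of translations is asked for; on a product it can be checked
    coordinatewise. *)
Lemma Bor_sumset (Z : PreTopologicalZmodule.type) (A D : set Z) :
  (forall d : Z, continuous (fun z : Z => z - d)) ->
  countable D -> Bor A -> Bor (sumset A D).
Proof.
move=> hc /pfcard_geP[->|[e]] bA.
  rewrite (_ : sumset A set0 = set0); first exact: Bor_set0.
  by apply/seteqP; split=> [z [a _ [b []]]|z []].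
rewrite (_ : sumset A D = \bigcup_n ((fun z => z - e n) @^-1` A)).
  by apply: Bor_bigcup => n; exact: Bor_preimage.
apply/seteqP; split=> [z [a Aa [d Dd <-]]|z [n _ /= Azn]].
  have [n _ en] : (e @` setT) d by exact: (@surj _ _ _ _ e).
  by exists n => //=; rewrite en addrK.
by exists (z - e n) => //; exists (e n); [exact: funS|rewrite subrK].
Qed.

Section product.
Variables X Y : topologicalZmodType.

Lemma prod_subr_continuous (d : X * Y) : continuous (fun z : X * Y => z - d).
Proof.
have subc (M : topologicalZmodType) (c : M) : continuous (fun z : M => z - c).
  move=> z; apply: (@continuous_comp _ _ _ (fun z => (z, c))
    (fun x : M * M => x.1 - x.2)); last exact: sub_continuous.
  by apply: cvg_pair; [exact: cvg_id|exact: cvg_cst].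
move=> z.
have c1 : (w.1 - d.1) @[w --> z] --> z.1 - d.1.
  exact: (@continuous_comp _ _ _ fst _ z cvg_fst (@subc X d.1 z.1)).
have c2 : (w.2 - d.2) @[w --> z] --> z.2 - d.2.
  exact: (@continuous_comp _ _ _ snd _ z cvg_snd (@subc Y d.2 z.2)).
exact: (cvg_pair c1 c2).
Qed.

Variables (I : set (set X)) (J : set (set Y)).
Hypotheses (hI : sigma_ideal I) (hJ : sigma_ideal J).

(** Over [x + d] with [x] in [B] and [d] in [D1], the section of the sumset
    contains [xsection A x + D2]; and [B + D1] is already [I]-residual. The
    complement of the sumset is Borel, hence is its own witness for membership
    in the Fubini product. *)
Lemma residual_sumset_of_positive_fibres (D1 : set X) (D2 : set Y)
    (A : set (X * Y)) (B : set X) :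
  countable D1 -> countable D2 ->
  (forall C : set X, Bor C -> positive I C -> residual I (sumset C D1)) ->
  (forall C : set Y, Bor C -> positive J C -> residual J (sumset C D2)) ->
  Bor A -> Bor B -> positive I B ->
  (forall x, B x -> positive J (xsection A x)) ->
  residual (fubini_product I J) (@sumset (X * Y)%type A (D1 `*` D2)).
Proof.
move=> c1 c2 s1 s2 bA bB posB posA.
exists (~` @sumset (X * Y)%type A (D1 `*` D2)); split=> //.
  apply: BorC; apply: Bor_sumset => //; first exact: prod_subr_continuous.
  exact: countableX.
apply: (sigma_ideal_sub hI _ (s1 _ bB posB)) => x /= nJ [b Bb [d Dd bdx]].
apply: nJ; have := s2 _ (Bor_xsection b bA) (posA _ Bb).
apply: (sigma_ideal_sub hJ) => y; rewrite /xsection /= inE => nA [a Aba [e De aey]].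
apply: nA; exists (b, a); first by move: Aba; rewrite /xsection /= inE.
exists (d, e) => //.
by rewrite -bdx -aey.
Qed.

Lemma positive_xsections (A : set (X * Y)) :
  Bor A -> positive (fubini_product I J) A ->
  positive I [set x | ~ J (xsection A x)].
Proof. by move=> bA posA IA; apply: posA; exists A; split. Qed.

End product.

Section positive_borel_subsets.
Variables X Y : topologicalType.
Variables (I : set (set X)) (J : set (set Y)).
Hypotheses (hI : sigma_ideal I) (hJ : sigma_ideal J).
Hypothesis Ibase : has_borel_base I.

(** The sets that agree with a Borel set off a member of [I] form a
    sigma-algebra containing [Bor X] and [I]. The exceptional set is enlarged
    to a Borel one so that removing it leaves a Borel set. *)
Lemma borel_core_of_measurable (S : set X) :
  <<s @Bor X `|` I >> S -> positive I S ->
  exists B : set X, [/\ Bor B, positive I B & B `<=` S].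
Proof.
pose G := [set S : set X | exists B N : set X,
  [/\ Bor B, I N & forall x, ~ N x -> (S x <-> B x)]].
have GS : <<s @Bor X `|` I >> `<=` G.
  apply: smallest_sub; last first.
    move=> C [bC|IC]; first by exists C, set0; split=> //; case: hI.
    by exists set0, C; split=> //; exact: Bor_set0.
  split.
  - by exists set0, set0; split=> //; [exact: Bor_set0|case: hI].
  - move=> C [B [N [bB IN CB]]]; exists (~` B), N; split=> //; first exact: BorC.
    by move=> x /CB[CBx BCx]; rewrite setTD; split=> [nC /BCx|nB /CBx].
  - move=> F /choice[B] /choice[N] BN.
    exists (\bigcup_n B n), (\bigcup_n N n); split.
    + by apply: Bor_bigcup => n; have [] := BN n.
    + by case: hI => _ _; apply=> n; have [] := BN n.
    + move=> x nN; split=> -[n _ xn]; exists n => //; have [_ _ E] := BN n;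
        by apply/E => // Nx; apply: nN; exists n.
move=> /GS[B [N [bB IN SB]]] posS.
have [N' [bN' IN' NN']] := Ibase IN.
exists (B `\` N'); split; first exact: BorD.
- move=> IB; apply: posS; apply: (sigma_ideal_sub hI _ (sigma_idealU hI IB IN')).
  move=> x Sx; have [N'x|nN'x] := pselect (N' x); first by right.
  by left; split=> //; apply/SB => // /NN'.
- by move=> x [Bx nN'x]; apply/SB => // /NN'.
Qed.

(** If [P] were in [I] or [Q] in [J], then Borel hulls would put the rectangle
    in the Fubini product. *)
Lemma positive_rectangle (Jbase : has_borel_base J) (P : set X) (Q : set Y) :
  positive (fubini_product I J) (P `*` Q) -> positive I P /\ positive J Q.
Proof.
have fst_c : continuous (@fst X Y) by move=> ?; exact: cvg_fst.
have snd_c : continuous (@snd X Y) by move=> ?; exact: cvg_snd.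
have [J0 _ _] := hJ; have [I0 _ _] := hI.
move=> pos; split=> [/Ibase[P' [bP' IP' PP']]|/Jbase[Q' [bQ' JQ' QQ']]];
  apply: pos.
- exists (fst @^-1` P'); split; first exact: Bor_preimage.
    by move=> [x y] /= [/PP'].
  apply: (sigma_ideal_sub hI _ IP') => x /=; apply: contra_notP => nP'x.
  apply: (sigma_ideal_sub hJ _ J0) => y.
  by rewrite /xsection /= inE.
- exists (snd @^-1` Q'); split; first exact: Bor_preimage.
    by move=> [x y] /= [_ /QQ'].
  apply: (sigma_ideal_sub hI _ I0) => x /=; apply.
  by apply: (sigma_ideal_sub hJ _ JQ') => y; rewrite /xsection /= inE.
Qed.

(** For all [x] of [P] outside an [I]-small Borel set, the section of [K] at
    [x] is in [J], and then [Q] is covered by [xsection A x] and that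
    section. *)
Lemma borel_core_of_rectangle (A K : set (X * Y)) (P : set X) (Q : set Y) :
  Bor P -> positive I P -> positive J Q -> fubini_product I J K ->
  P `*` Q `<=` A `|` K ->
  exists B : set X,
    [/\ Bor B, positive I B & B `<=` [set x | ~ J (xsection A x)]].
Proof.
move=> bP posP posQ [C [_ KC /Ibase[N [bN IN CN]]]] PQ.
exists (P `\` N); split; first exact: BorD.
- move=> IPN; apply: posP; apply: (sigma_ideal_sub hI _ (sigma_idealU hI IPN IN)).
  by move=> x Px; have [Nx|nNx] := pselect (N x); [right|left].
- move=> x [Px nNx] /= JA; apply: posQ.
  have JC : J (xsection C x) by apply: contra_notP nNx => /CN.
  apply: (sigma_ideal_sub hJ _ (sigma_idealU hJ JA JC)) => y Qy.
  have [Axy|/KC Cxy] := PQ (x, y) (conj Px Qy).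
    by left; rewrite /xsection /= inE.
  by right; rewrite /xsection /= inE.
Qed.

End positive_borel_subsets.

Theorem theorem18 (R : realType) (X Y : topologicalZmodType)
    (hX : polish R X) (hY : polish R Y)
    (I : set (set X)) (J : set (set Y))
    (hI : sigma_ideal I) (hJ : sigma_ideal J)
    (I1 : contains_singletons I) (J1 : contains_singletons J)
    (Ibase : has_borel_base I) (Jbase : has_borel_base J)
    (Iwsp : WSP I) (Jwsp : WSP J)
    (h : borel_on_borel X J \/ measurable_on_measurable I J \/ PRP I J) :
  @WSP (X * Y)%type (fubini_product I J).
Proof.
have [D1 [c1 d1 s1]] := Iwsp; have [D2 [c2 d2 s2]] := Jwsp.
exists (D1 `*` D2); split; [exact: countableX|exact: dense_setX|].
move=> A bA posA.
suff [B [bB posB BA]] : exists B : set X,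
    [/\ Bor B, positive I B & B `<=` [set x | ~ J (xsection A x)]].
  exact: (residual_sumset_of_positive_fibres hI hJ c1 c2 s1 s2 bA bB posB).
have posE := positive_xsections bA posA.
case: h => [JB|[JM|prp]].
- exists [set x | ~ J (xsection A x)]; split=> //.
  exact: (BorC (JB A bA)).
- apply: (borel_core_of_measurable hI Ibase) => //.
  have [_ mC _] := smallest_sigma_algebra setT (@Bor X `|` I).
  have -> : [set x | ~ J (xsection A x)] = setT `\` [set x | J (xsection A x)].
    by rewrite setTD.
  by apply: mC; apply: JM; apply: sub_sigma_algebra; left.
- have [P [Q [bP _ posPQ [K hK PQ]]]] := prp _ bA posA.
  have [posP posQ] := positive_rectangle hI hJ Ibase Jbase posPQ.
  exact: (borel_core_of_rectangle hI hJ Ibase bP posP posQ hK PQ).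
Qed.
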